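(* Group rationality is satisfied under Dynamic NEM (D-NEM): let $\mathcal H\subseteq\mathcal S\subseteq\mathcal N$ be nonempty sets of customers, and for $\mathcal C\in\{\mathcal H,\mathcal S\}$ and $i\in\mathcal C$ let $S^{\chi^*}_{i,\mathcal C}$ denote the surplus of member $i$, under its optimal consumption, when it belongs to the community $\mathcal C$ operated under D-NEM. Then $$\sum_{i\in\mathcal H}S^{\chi^*}_{i,\mathcal S}\ \ge\ \sum_{i\in\mathcal H}S^{\chi^*}_{i,\mathcal H}.$$
   Context: Setting. $\mathcal N=\{1,\dots,N\}$ is a set of customers, $\mathcal K=\{1,\dots,K\}$ a set of devices. Customer $i$ chooses a consumption bundle $\bm d_i=(d_{i1},\dots,d_{iK})\in\mathcal D_i=\{\bm d_i:\underline{\bm d}_i\preceq\bm d_i\preceq\overline{\bm d}_i\}\subseteq\mathbb R_+^K$ (elementwise finite bounds, $\mathcal D_i$ nonempty) and has renewable generation $g_i\ge 0$; net consumption is $z_i=\bm 1^\top\bm d_i-g_i$. Utilities. $U_i(\bm d_i)=\sum_{k\in\mathcal K}U_{ik}(d_{ik})$, where each $U_{ik}$ is concave, non-decreasing and continuously differentiable; the marginal utility $L_{ik}=U_{ik}'$ is assumed invertible (strictly decreasing), with inverse $f_{ik}=L_{ik}^{-1}$ defined (with values in $\mathbb R_+$) at every price in $[\pi^-,\pi^+]$, where $0\le\pi^-\le\pi^+$ are the utility's sell and buy rates. D-NEM for a community $\mathcal C\subseteq\mathcal N$. Put $g_{\mathcal C}=\sum_{i\in\mathcal C}g_i$ and $f_{\mathcal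 C}(y)=\sum_{i\in\mathcal C}\sum_{k\in\mathcal K}\max\{\underline d_{ik},\min\{f_{ik}(y),\overline d_{ik}\}\}$. The community price is $\pi^*_{\mathcal C}=\pi^+$ if $g_{\mathcal C}<f_{\mathcal C}(\pi^+)$; $\pi^*_{\mathcal C}=\pi^z_{\mathcal C}$ if $g_{\mathcal C}\in[f_{\mathcal C}(\pi^+),f_{\mathcal C}(\pi^-)]$, where $\pi^z_{\mathcal C}$ is a solution $\mu\in[\pi^-,\pi^+]$ of $f_{\mathcal C}(\mu)=g_{\mathcal C}$; and $\pi^*_{\mathcal C}=\pi^-$ if $g_{\mathcal C}>f_{\mathcal C}(\pi^-)$. Each member $i\in\mathcal C$ pays $\pi^*_{\mathcal C}\,z_i$. The member's optimal consumption is $d_{ik}^{\psi^*}=\max\{\underline d_{ik},\min\{f_{ik}(\pi^*_{\mathcal C}),\overline d_{ik}\}\}$, $k\in\mathcal K$, with net consumption $z_i^{\psi^*}=\bm 1^\top\bm d_i^{\psi^*}-g_i$, and its surplus is $S^{\chi^*}_{i,\mathcal C}=U_i(\bm d_i^{\psi^*})-\pi^*_{\mathcal C}\,z_i^{\psi^*}$. *)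

(* Defs.v *)
From HB Require Import structures.
From mathcomp Require Import all_boot all_order all_algebra.
From mathcomp Require Import all_classical all_reals all_analysis.

Set Implicit Arguments.
Unset Strict Implicit.
Unset Printing Implicit Defensive.

Import Order.TTheory GRing.Theory Num.Theory.
Import numFieldNormedType.Exports.

Local Open Scope classical_set_scope.
Local Open Scope ring_scope.

Definition concave_on (R : realType) (X : set R) (u : R -> R) : Prop :=
  convex_function (X : set R^o) (fun x => - u x).

(* The difference quotient is taken inside X, so at an endpoint of an interval
   this is the one-sided derivative, and values of u outside X are irrelevant. *)
Definition is_derivative_on (R : realType) (X : set R) (u l : R -> R) : Prop :=
  forall x, X x -> (u y - u x) / (y - x) @[y --> within X x^'] --> l x.

Record market (R : realType) (N K : nat) := Market {
  sell_rate : R;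
  buy_rate : R;
  gen : 'I_N -> R;
  dmin : 'I_N -> 'I_K -> R;
  dmax : 'I_N -> 'I_K -> R;
  (* the set of consumption levels on which the utility of device k of customer
     i is defined, e.g. [0, +oo[ *)
  udom : 'I_N -> 'I_K -> set R;
  util : 'I_N -> 'I_K -> R -> R;
  (* the derivative of util *)
  marg : 'I_N -> 'I_K -> R -> R;
  (* the inverse of marg *)
  inv_marg : 'I_N -> 'I_K -> R -> R }.

Record market_assumptions (R : realType) (N K : nat) (m : market R N K) : Prop :=
  MarketAssumptions {
  sell_rate_ge0 : 0 <= sell_rate m;
  sell_le_buy : sell_rate m <= buy_rate m;
  gen_ge0 : forall i, 0 <= gen m i;
  dmin_le_dmax : forall i k, dmin m i k <= dmax m i k;
  udom_interval : forall i k, is_interval (udom m i k);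
  udom_ge0 : forall i k, udom m i k `<=` [set x | 0 <= x];
  bounds_in_udom : forall i k, [set` `[dmin m i k, dmax m i k]] `<=` udom m i k;
  util_concave : forall i k, concave_on (udom m i k) (util m i k);
  util_nondecreasing : forall i k,
    {in udom m i k &, {homo util m i k : x y / x <= y}};
  util_derivative : forall i k,
    is_derivative_on (udom m i k) (util m i k) (marg m i k);
  marg_continuous : forall i k, {within udom m i k, continuous (marg m i k)};
  marg_decreasing : forall i k,
    {in udom m i k &, {homo marg m i k : x y /~ x < y}};
  inv_margP : forall i k (p : R), sell_rate m <= p <= buy_rate m ->
    udom m i k (inv_marg m i k p) /\ marg m i k (inv_marg m i k p) = p }.

Section DynamicNEM.
Variables (R : realType) (N K : nat) (m : market R N K).
Implicit Types (C : {set 'I_N}) (i : 'I_N) (p : R).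

Definition utility i (d : 'I_K -> R) : R := \sum_(k < K) util m i k (d k).

Definition net_consumption i (d : 'I_K -> R) : R := \sum_(k < K) d k - gen m i.

Definition opt_consumption p i (k : 'I_K) : R :=
  Num.max (dmin m i k) (Num.min (inv_marg m i k p) (dmax m i k)).

Definition community_gen C : R := \sum_(i in C) gen m i.

Definition community_demand C p : R :=
  \sum_(i in C) \sum_(k < K) opt_consumption p i k.

(* f_C(mu) = g_C may have several solutions (demand is flat where the bounds
   bind); pz is an arbitrary selection of one for each nonempty community in
   the net-zero zone. *)
Definition is_netzero_price (pz : {set 'I_N} -> R) : Prop :=
  forall C, (0 < #|C|)%N ->
    community_demand C (buy_rate m) <= community_gen C
      <= community_demand C (sell_rate m) ->
    sell_rate m <= pz C <= buy_rate m /\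
    community_demand C (pz C) = community_gen C.

Definition dnem_price (pz : {set 'I_N} -> R) C : R :=
  if community_gen C < community_demand C (buy_rate m) then buy_rate m
  else if community_gen C <= community_demand C (sell_rate m) then pz C
  else sell_rate m.

Definition dnem_payment (pz : {set 'I_N} -> R) C i (d : 'I_K -> R) : R :=
  dnem_price pz C * net_consumption i d.

Definition dnem_surplus (pz : {set 'I_N} -> R) C i : R :=
  let d := opt_consumption (dnem_price pz C) i in
  utility i d - dnem_payment pz C i d.

End DynamicNEM.

(* Main.v *)
Require Import Defs.
From HB Require Import structures.
From mathcomp Require Import all_boot all_order all_algebra.
From mathcomp Require Import all_classical all_reals all_analysis.
From mathcomp Require Import lra.

Import Order.TTheory GRing.Theory Num.Theory.
Import numFieldNormedType.Exports.

Local Open Scope ring_scope.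

(** Write [V_i(p) = max_d (U_i(d) - p (1.d - g_i))].  Concavity makes the clamped
    inverse marginal utility a maximizer, so the surplus of member [i] in a
    community with price [p] is [V_i(p)].  If [q] is the price of [H] and [p]
    that of [S], bounding [V_i(p)] below by the consumption that is optimal at
    [q] gives [sum_H V_i(p) >= sum_H V_i(q) + (q - p) Z], with [Z] the net
    consumption of [H] at [q].  D-NEM makes [(q - p) Z >= 0] for every
    [p] in [[sell_rate, buy_rate]]: [q] is the buy rate if [Z > 0], the sell rate
    if [Z < 0], and otherwise [Z = 0]. *)

Lemma concave_on_chord (R : realType) (X : set R) (u : R -> R) (x y t : R) :
  concave_on X u -> X x -> X y -> 0 <= t <= 1 ->
  t * (u y - u x) <= u (x + t * (y - x)) - u x.
Proof.
move=> cu Xx Xy /andP[t0 t1].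
(* The weight [t] of the convex combination falls on its first argument, so [y] comes first. *)
have := cu (Itv01 t0 t1) y x; rewrite !inE => /(_ Xy Xx).
rewrite !convRE /= /unstable.onem.
have -> : conv (Itv01 t0 t1) (y : convex_lmodType R^o) x = x + t * (y - x).
  by rewrite [LHS](convRE y x) /= /unstable.onem; lra.
lra.
Qed.

(** By concavity, [u y - u x] is at most the difference quotient at any [z] strictly between [x] and
    [y], scaled by [y - x]. A [z] close enough to [x] contradicts a failure of the tangent bound. *)
Lemma concave_on_tangent (R : realType) (X : set R) (u l : R -> R) (x y : R) :
  is_interval X -> concave_on X u -> is_derivative_on X u l -> X x -> X y ->
  u y - u x <= l x * (y - x).
Proof.
move=> iX cu du Xx Xy.
have [->|yx] := eqVneq y x; first by rewrite !subrr mulr0.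
have yx0 : y - x != 0 by rewrite subr_eq0.
rewrite leNgt; apply/negP => lt_u.
(* Scaling the quotient by [y - x] treats [y] on either side of [x] at once. *)
have /nbhs_ballP[e /= e0 He] : nbhs x (fun z => z != x -> X z ->
    (u z - u x) / (z - x) * (y - x) < u y - u x).
  exact: (cvgr_lt _ (cvgMr_tmp (b := y - x) (du x Xx)) _ lt_u).
(* The cap [1] keeps [z] on the segment from [x] to [y], hence in [X]; the other bound puts [z]
   within [e / 2] of [x]. *)
pose t := Num.min 1 (e / 2 / `|y - x|).
have yxn : 0 < `|y - x| by rewrite normr_gt0.
have t0 : 0 < t by rewrite lt_min ltr01 !divr_gt0.
have t1 : t <= 1 by rewrite ge_min lexx.
have te : t * `|y - x| <= e / 2 by rewrite -ler_pdivlMr// ge_min lexx orbT.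
pose z := x + t * (y - x).
have zx : z - x = t * (y - x) by rewrite /z addrC addKr.
have Xz : X z.
  have [xy|xy] := leP x y.
    apply: (iX x y) => //; rewrite /z; apply/andP; split; nra.
  by apply: (iX y x) => //; rewrite /z; apply/andP; split; nra.
have zNx : z != x by rewrite -subr_eq0 zx mulf_neq0// gt_eqF.
have bz : ball x e z.
  rewrite /ball /= distrC zx normrM gtr0_norm//.
  by rewrite (le_lt_trans te)// ltr_pdivrMr// ltr_pMr// ltr1n.
have := He z bz zNx Xz.
rewrite ltNge => /negP; apply.
rewrite zx invfM mulrA mulfVK// ler_pdivlMr// mulrC.
by apply: concave_on_chord => //; rewrite (ltW t0) t1.
Qed.

Section Market.
Context {R : realType} {N K : nat} {m : market R N K}.
Hypothesis mA : market_assumptions m.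
Implicit Types (C : {set 'I_N}) (i : 'I_N) (k : 'I_K) (p q : R).

Let valid_price p := sell_rate m <= p <= buy_rate m.

Lemma opt_consumption_bounds p i k :
  dmin m i k <= opt_consumption m p i k <= dmax m i k.
Proof.
rewrite /opt_consumption le_max lexx/= ge_max dmin_le_dmax//=.
by rewrite ge_min lexx orbT.
Qed.

Lemma opt_consumption_max p i k (y : R) : valid_price p ->
  dmin m i k <= y <= dmax m i k ->
  util m i k y - p * y
    <= util m i k (opt_consumption m p i k) - p * opt_consumption m p i k.
Proof.
move=> pv yv.
have [Xc lc] := inv_margP mA i k pv.
have bX z : dmin m i k <= z <= dmax m i k -> udom m i k z.
  by move=> zv; apply: (bounds_in_udom mA); rewrite /= in_itv.
have xv := opt_consumption_bounds p i k.
set x := opt_consumption m p i k in xv *.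
have Xx := bX _ xv; have Xy := bX _ yv.
have tang : util m i k y - util m i k x <= marg m i k x * (y - x).
  apply: concave_on_tangent Xx Xy; first exact: (@udom_interval _ _ _ _ mA).
    exact: (@util_concave _ _ _ _ mA).
  exact: (@util_derivative _ _ _ _ mA).
(* By the tangent bound at [x], the first-order optimality condition on the interval suffices. *)
suff : (marg m i k x - p) * (y - x) <= 0 by lra.
have mono := @marg_decreasing _ _ _ _ mA i k.
(* Unclamped, the marginal utility at [x] is [p]; clamped below, it is less than [p] and [y >= x];
   clamped above, it exceeds [p] and [y <= x]. *)
have : [\/ x = inv_marg m i k p, x = dmin m i k /\ inv_marg m i k p < x
         | x = dmax m i k /\ x < inv_marg m i k p].
  rewrite /x /opt_consumption; have dd := dmin_le_dmax mA i k.
  case: (leP (inv_marg m i k p) (dmax m i k)) => ?.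
    by case: (leP (dmin m i k)) => ?; [constructor 1|constructor 2].
  by rewrite (max_idPr dd); constructor 3.
case/andP: yv => y1 y2.
case=> [->|[xE cx]|[xE cx]]; first by rewrite lc subrr mul0r.
  have := mono x (inv_marg m i k p); rewrite !inE => /(_ Xx Xc cx).
  rewrite lc => ?; apply: mulr_le0_ge0; lra.
have := mono (inv_marg m i k p) x; rewrite !inE => /(_ Xc Xx cx).
rewrite lc => ?; apply: mulr_ge0_le0; lra.
Qed.

(** The generation term [p * gen m i] is the same on both sides; what remains separates over
    devices. *)
Lemma opt_surplus_max p q i : valid_price p ->
  utility m i (opt_consumption m q i)
      - p * net_consumption m i (opt_consumption m q i)
    <= utility m i (opt_consumption m p i)
      - p * net_consumption m i (opt_consumption m p i).
Proof.
move=> pv; rewrite /utility /net_consumption !mulrBr !opprB.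
rewrite ![_ + (p * gen m i - _)]addrA -![_ + _ - _]addrAC lerD2r.
rewrite !mulr_sumr -!sumrB.
by apply: ler_sum => k _; apply/opt_consumption_max/opt_consumption_bounds.
Qed.

Lemma sum_net_consumption C p :
  \sum_(i in C) net_consumption m i (opt_consumption m p i)
    = community_demand m C p - community_gen m C.
Proof. by rewrite sumrB. Qed.

Variable pz : {set 'I_N} -> R.
Hypothesis pzP : is_netzero_price m pz.

Lemma dnem_price_valid C : (0 < #|C|)%N -> valid_price (dnem_price m pz C).
Proof.
move=> C0; have sb := sell_le_buy mA; rewrite /dnem_price /valid_price.
case: (ltP (community_gen m C)) => [_|h1]; first by rewrite sb lexx.
case: (leP (community_gen m C)) => [h2|_]; last by rewrite sb lexx.
by case: (pzP _ C0) => //; rewrite h1.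
Qed.

Lemma dnem_price_net C p : (0 < #|C|)%N -> valid_price p ->
  0 <= (dnem_price m pz C - p)
       * (community_demand m C (dnem_price m pz C) - community_gen m C).
Proof.
move=> C0 /andP[p1 p2]; rewrite /dnem_price.
case: (ltP (community_gen m C)) => [h|h1]; first by apply: mulr_ge0; lra.
case: (leP (community_gen m C)) => [h2|h2]; last by apply: mulr_le0; lra.
by case: (pzP _ C0) => [|_ ->]; rewrite ?h1// subrr mulr0.
Qed.

End Market.

Theorem theorem2 (R : realType) (N K : nat) (m : market R N K)
    (pz : {set 'I_N} -> R) (H S : {set 'I_N}) :
  market_assumptions m ->
  is_netzero_price m pz ->
  (0 < #|H|)%N ->
  H \subset S ->
  \sum_(i in H) dnem_surplus m pz S i >= \sum_(i in H) dnem_surplus m pz H i.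
Proof.
move=> mA pzP H0 HS.
have S0 : (0 < #|S|)%N := leq_trans H0 (subset_leq_card HS).
have pv := dnem_price_valid mA _ pzP _ S0.
have net := dnem_price_net _ pzP _ _ H0 pv.
rewrite /dnem_surplus /dnem_payment.
set p := dnem_price m pz S in pv net *.
set q := dnem_price m pz H in net *.
(* Intermediate value: members of [H] consume as under [q] but pay the price [p] of [S]. *)
apply: (@le_trans _ _ (\sum_(i in H) (utility m i (opt_consumption m q i)
    - p * net_consumption m i (opt_consumption m q i)))); last first.
  by apply: ler_sum => i _; exact: opt_surplus_max.
(* The utilities now agree on both sides, and the difference of payments is the quantity in
   [net]. *)
rewrite !sumrB -!mulr_sumr sum_net_consumption.
lra.
Qed.
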